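(* Let $n\ge 2$ and $0\le k\le \lfloor n/3\rfloor$ be integers, and let $R$ be a random subset of the cyclic group $C_n$ obtained by choosing each element of $C_n$ independently with probability $p$. Let $N^R_{n-1-k}$ be the number of zero-sum free sequences of length $n-1-k$ contained in $R$. Then $$\mathbb E\left(N^R_{n-1-k}\right)=\varphi(n)\left[p+\sum_{d=2}^{D}p^d\left(\sum_{j=\frac{(d-1)d}{2}}^{k}q(j,d-1)\right)\right],$$ where $D=\left\lfloor\frac{1+\sqrt{1+8k}}{2}\right\rfloor$, $\varphi(n)$ denotes the number of generators of $C_n$, and $q(j,d-1)$ is the number of partitions of $j$ having exactly $d-1$ distinct parts.
   Context: $C_n$ is the cyclic group of order $n$, written additively. A sequence of length $\ell$ over $C_n$ is an unordered collection with repetition allowed (a multiset) $S=a_1\cdot a_2\cdot\ldots\cdot a_\ell$ of $\ell$ elements of $C_n$. A subsequence of $S$ is a sequence $T$ in which the multiplicity of each $a\in C_n$ is at most its multiplicity in $S$. $S$ is a zero-sum sequence if $a_1+\dots+a_\ell=0$, and $S$ is zero-sum free if it contains no (nonempty) zero-sum subsequence. $S$ is contained in $A\subset C_n$ if every element occurring in $S$ lies in $A$. A partition of a positive integer $j$ is a non-decreasing sequence of positive integers with sum $j$. For $j,d\ge1$, $q(j,d)$ is the number of partitions of $j$ in which exactly $d$ different part sizes occur (parts may be repeated); e.g. $q(7,1)=2$, $q(7,2)=11$, $q(7,3)=2$. Empty sums are $0$.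
   Formalization: The pairs (n,k) = (3,1) and (6,2) are excluded, because there the stated formula is false for every p > 0 (for (3,1) the expectation is 2p but the formula gives 2(p+p²)). *)

(* Defs.v *)
From HB Require Import structures.
From mathcomp Require Import all_boot all_order all_algebra all_fingroup cyclic.
From mathcomp Require Import finmap multiset.
From mathcomp Require Import all_classical all_reals all_analysis.
Set Implicit Arguments.
Unset Strict Implicit.
Unset Printing Implicit Defensive.
Import Order.TTheory GRing.Theory Num.Theory.
Local Open Scope mset_scope.
Local Open Scope classical_set_scope.
Local Open Scope ring_scope.

(* C_n is 'Z_n (only meaningful for 1 < n) and sequences over C_n, being
   unordered, are multisets {mset 'Z_n}; "T is a subsequence of S" is the
   multiset inclusion (T `<=` S)%mset. *)

Definition zero_sum (n : nat) (S : {mset 'Z_n}) : bool :=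
  \sum_(a <- S) a == 0.

Definition zero_sum_free (n : nat) (S : {mset 'Z_n}) : Prop :=
  forall T : {mset 'Z_n}, (T `<=` S)%mset -> T != mset0 -> ~~ zero_sum T.

Definition contained (n : nat) (S : {mset 'Z_n}) (A : {set 'Z_n}) : Prop :=
  forall a : 'Z_n, a \in S -> a \in A.

(* A multiset has size l iff it is the multiset of entries of some l-tuple. *)
Definition sequences (n l : nat) : {fset {mset 'Z_n}} :=
  [fset seq_mset (tval t) | t in {: l.-tuple 'Z_n}]%fset.

Definition num_zero_sum_free (n l : nat) (A : {set 'Z_n}) : nat :=
  #|` [fset S in sequences n l | `[< zero_sum_free S /\ contained S A >]]%fset|.

Definition num_generators (n : nat) : nat :=
  #|[set g : 'Z_n | generator [set: 'Z_n]%SET g]%SET|.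

(* A partition of j has at most j parts, each at most j, so every partition
   of j is a bounded sequence in {bseq j of 'I_j.+1}. *)
Definition num_partitions (j d : nat) : nat :=
  #|[set t : {bseq j of 'I_j.+1} |
      let s := [seq val i | i <- t] in
      [&& sorted leq s, 0%N \notin s, sumn s == j & size (undup s) == d]]%SET|.

Definition mutually_independent (d : measure_display) (W : measurableType d)
    (R : realType) (P : probability W R) (I : finType) (E : I -> set W) : Prop :=
  forall A : {set I},
    P (\bigcap_(i in [set` A]) E i) = (\prod_(i in A) P (E i))%E.

(* The bounds 0 <= p <= 1 are implied by the second clause. *)
Definition random_subset (d : measure_display) (W : measurableType d)
    (R : realType) (P : probability W R) (T : finType) (p : R)
    (X : W -> {set T}) : Prop :=
  [/\ forall a : T, measurable [set w | a \in X w],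
      forall a : T, P [set w | a \in X w] = p%:E
    & mutually_independent P (fun a : T => [set w | a \in X w])].

(* Main.v *)
Require Import Defs.
From HB Require Import structures.
From mathcomp Require Import all_boot all_order all_algebra all_fingroup cyclic.
From mathcomp Require Import finmap multiset.
From mathcomp Require Import all_classical all_reals all_analysis.
From mathcomp Require Import measurable_realfun zify lra.
Import Order.TTheory GRing.Theory Num.Theory.
Local Open Scope ring_scope.

(** Savchev and Chen: a zero-sum free sequence of length l with 2 l > n is
    g y_1, ..., g y_l for a generator g and integers y_i >= 1 of sum < n. For
    l = n - 1 - k this says that the y_i - 1 form a partition of some j <= k,
    padded with zeros; 2 l > n fails only for (n, k) = (2, 0) and (4, 1), which
    are checked by hand, and in the excluded cases. Since k <= n / 3, the
    multiplicity of g is so large that g is determined by the sequence; hence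
    these sequences correspond to pairs (generator, partition of some j <= k),
    and the number of distinct terms is one more than the number of distinct
    parts. The expectation is the sum of p ^ (number of distinct terms). *)

Set Implicit Arguments.
Unset Strict Implicit.
Unset Printing Implicit Defensive.

(** * Long zero-sum free sequences *)

(** The list counterpart of [zero_sum_free]: [t] is a subsequence with complement [u], so inclusion
    of multisets becomes [perm_eq]. *)
Definition zsum_free (G : zmodType) (s : seq G) : Prop :=
  forall t u, perm_eq (t ++ u) s -> \sum_(a <- t) a = 0 -> t = [::].

(* Contains 0, the sum of the empty subsequence. *)
Definition subsums (G : finZmodType) (s : seq G) : {set G} :=
  [set x | `[< exists t u, perm_eq (t ++ u) s /\ x = \sum_(a <- t) a >]]%SET.

Section Subsums.
Variable G : finZmodType.
Implicit Types (s t u : seq G) (a b x : G).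

Lemma subsumsP s x :
  reflect (exists t u, perm_eq (t ++ u) s /\ x = \sum_(a <- t) a)
          (x \in subsums s).
Proof. by rewrite inE; apply: asboolP. Qed.

Lemma subsums_perm s s' : perm_eq s s' -> subsums s = subsums s'.
Proof.
move=> ss'; apply/setP => x; apply/subsumsP/subsumsP => -[t [u [tu ->]]];
exists t, u; split=> //; first exact: perm_trans tu ss'.
by rewrite perm_sym in ss'; exact: perm_trans tu ss'.
Qed.

Lemma zsum_free_perm s s' : perm_eq s s' -> zsum_free s -> zsum_free s'.
Proof.
by rewrite perm_sym => ss' zs t u tu; apply: zs (perm_trans tu ss').
Qed.

Lemma subsums0 s : 0 \in subsums s.
Proof. by apply/subsumsP; exists [::], s; rewrite big_nil. Qed.

Lemma subsums_cons a s x :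
  (x \in subsums (a :: s)) = (x \in subsums s) || (x - a \in subsums s).
Proof.
apply/subsumsP/orP => [[t [u [tu ->]]]|[|]].
- have : a \in t ++ u by rewrite (perm_mem tu) mem_head.
  rewrite mem_cat => /orP[at_|au]; [right|left]; apply/subsumsP.
    exists (rem a t), u; split.
      have := perm_cat (perm_to_rem at_) (perm_refl u).
      by rewrite (permPl tu) /= perm_cons perm_sym.
    by rewrite (perm_big _ (perm_to_rem at_)) big_cons/= [a + _]addrC addrK.
  exists t, (rem a u); split=> //.
  have := perm_cat (perm_refl t) (perm_to_rem au).
  by rewrite (permPl tu) perm_sym -[_ :: rem _ _]cat1s perm_catCA/= perm_cons.
- case/subsumsP=> t [u [tu ->]]; exists t, (a :: u); split=> //.
  by rewrite -[a :: u]cat1s perm_catCA/= perm_cons.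
- case/subsumsP=> t [u [tu xE]]; exists (a :: t), u; split.
    by rewrite /= perm_cons.
  by rewrite big_cons -xE addrC subrK.
Qed.

(** Exchanging a subsequence with its complement replaces [x] by the total minus [x]. *)
Lemma subsums_sym s x : (\sum_(a <- s) a - x \in subsums s) = (x \in subsums s).
Proof.
suff H y : y \in subsums s -> \sum_(a <- s) a - y \in subsums s.
  by apply/idP/idP => /H//; rewrite opprB addrC subrK.
case/subsumsP=> t [u [tu ->]]; apply/subsumsP; exists u, t; split.
  by rewrite perm_catC.
by rewrite -(perm_big _ tu) big_cat/= addrAC subrr add0r.
Qed.

Lemma zsum_free_behead a s : zsum_free (a :: s) -> zsum_free s.
Proof.
move=> z t u tu; apply: (z t (a :: u)).
by rewrite -[a :: u]cat1s perm_catCA/= perm_cons.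
Qed.

Lemma zsum_free_opp a s : zsum_free (a :: s) -> - a \notin subsums s.
Proof.
move=> z; apply/negP => /subsumsP[t [u [tu aE]]].
have /z : perm_eq ((a :: t) ++ u) (a :: s) by rewrite /= perm_cons.
by rewrite big_cons -aE subrr => /(_ erefl).
Qed.

(** * Multiples of an element of finite order *)

Lemma mulrn_order (b : G) : b *+ #[b]%g = 0.
Proof. by rewrite -FinRing.zmodXgE expg_order. Qed.

Lemma eq_mulrn_mod (b : G) i j : (b *+ i == b *+ j) = (i == j %[mod #[b]%g]).
Proof. by rewrite -!FinRing.zmodXgE eq_expg_mod_order. Qed.

Lemma mulrn_inj_lt (b : G) i j : (i < #[b]%g)%N -> (j < #[b]%g)%N ->
  b *+ i = b *+ j -> i = j.
Proof. by move=> iN jN /eqP; rewrite eq_mulrn_mod !modn_small// => /eqP. Qed.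

Lemma mulrn_neq_lt (b : G) i j : (i < #[b]%g)%N -> (j < #[b]%g)%N ->
  (i != j)%N -> b *+ i != b *+ j.
Proof. by move=> iN jN; apply: contra => /eqP/(mulrn_inj_lt iN jN)->. Qed.

Lemma opp_mulrn (b : G) i : (i <= #[b]%g)%N -> - (b *+ i) = b *+ (#[b]%g - i).
Proof. by move=> iN; rewrite mulrnBr// mulrn_order sub0r. Qed.

Lemma sub_subsums_cons a s : {subset subsums s <= subsums (a :: s)}.
Proof. by move=> x xs; rewrite subsums_cons xs. Qed.

Lemma zsum_free_neq0 a s : zsum_free s -> a \in s -> a != 0.
Proof.
move=> z as_; apply/eqP => a0.
have /z : perm_eq ([:: a] ++ rem a s) s by rewrite perm_sym perm_to_rem.
by rewrite big_seq1 => /(_ a0).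
Qed.

Lemma mem_subsums a s : a \in s -> a \in subsums s.
Proof.
move=> as_; apply/subsumsP; exists [:: a], (rem a s).
by rewrite big_seq1; split => //; rewrite perm_sym perm_to_rem.
Qed.

(* The conclusion of the Savchev-Chen theorem, with y.+1 in place of y: the
   [y.+1] sum to [sumn ys + size ys]. *)
Definition behaving s : Prop := exists b ys,
  [/\ perm_eq s [seq b *+ y.+1 | y <- ys], (sumn ys + size ys < #[b]%g)%N
    & forall i, (i <= sumn ys + size ys)%N -> b *+ i \in subsums s].

Lemma behaving_perm s s' : perm_eq s s' -> behaving s -> behaving s'.
Proof.
move=> ss' [b [ys [sy lt Xs]]]; exists b, ys; split=> //.
  by rewrite perm_sym in ss'; exact: perm_trans ss' sy.
by move=> i /Xs; rewrite (subsums_perm ss').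
Qed.

(* The subsums of s include b *+ i for i <= M. Unless a = b *+ x with x <= M + 1,
   these and their translates by a are 2 (M + 1) >= 2 (|s| + 1) distinct subsums. *)
Lemma behaving_cons a s : zsum_free (a :: s) -> behaving s ->
  (#|subsums (a :: s)| < 2 * (size s).+1)%N -> behaving (a :: s).
Proof.
move=> z [b [ys [sys MN Xs]]] card; set M := (_ + _)%N in MN Xs.
have Na := zsum_free_opp z.
have a0 : a != 0 by apply: (zsum_free_neq0 z); rewrite mem_head.
have [[x xM ax]|nx] := pselect (exists2 x, (x <= M)%N & a = b *+ x.+1).
  (* Otherwise [- a] would be [b *+ (#[b]%g - x.+1)] with a coefficient at most [M], hence a subsum
     of [s]. *)
  have lt : (M + x.+1 < #[b]%g)%N.
    rewrite ltnNge; apply/negP => le; case/negP: Na.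
    by rewrite ax opp_mulrn; [apply: Xs|]; lia.
  exists b, (x :: ys); split => /=.
  - by rewrite -ax perm_cons.
  - by move: lt; rewrite /M; lia.
  - move=> i iM; have [leiM|ltMi] := leqP i M.
      by rewrite subsums_cons Xs.
    rewrite subsums_cons ax -mulrnBr; last by lia.
    by apply/orP; right; apply: Xs; move: iM; rewrite /M; lia.
pose A := [set b *+ i | i : 'I_M.+1]%SET.
pose B := [set a + b *+ i | i : 'I_M.+1]%SET.
have cA : #|A| = M.+1.
  rewrite card_imset ?card_ord// => i j bij; apply/val_inj.
  by apply: mulrn_inj_lt bij; [have := ltn_ord i|have := ltn_ord j]; lia.
have cB : #|B| = M.+1.
  rewrite card_imset ?card_ord// => i j /addrI bij; apply/val_inj.
  by apply: mulrn_inj_lt bij; [have := ltn_ord i|have := ltn_ord j]; lia.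
(* A common element [b *+ i = a + b *+ j] is excluded by [a0] if [i = j], by [nx] if [i > j], and by
   [Na] if [i < j]. *)
have AB0 : (A :&: B = finset.set0)%SET.
  apply/finset.setP => x; rewrite !finset.inE; apply/andP => -[].
  case/imsetP => i _ ->; case/imsetP => j _ /eqP.
  rewrite -subr_eq => /eqP aE.
  have ltiM := ltn_ord i; have ltjM := ltn_ord j.
  have [leji|ltij] := leqP j i.
    apply: nx; exists (i - j).-1; first by lia.
    rewrite -aE -mulrnBr//; congr (_ *+ _).
    suff : (j != i :> nat) by lia.
    by apply: contra a0 => /eqP ji; rewrite -aE ji subrr.
  case/negP: Na; rewrite -aE opprB -mulrnBr ?(ltnW ltij)//.
  by apply: Xs; lia.
have sub : (A :|: B \subset subsums (a :: s))%SET.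
  apply/fintype.subsetP => x; rewrite finset.inE => /orP[] /imsetP[i _ ->].
    by rewrite subsums_cons Xs//; have := ltn_ord i; lia.
  by rewrite subsums_cons orbC [a + _]addrC addrK Xs//; have := ltn_ord i; lia.
have := subset_leq_card sub.
rewrite cardsU AB0 finset.cards0 cA cB => le.
have : size s = size ys by rewrite (perm_size sys) size_map.
by have := leq_ltn_trans le card; rewrite /M; lia.
Qed.

(** If the total of [s] were a subsum of [rem a s], then by symmetry so would be [- a]. Removing [a]
    thus loses the total, and by the cardinality hypothesis nothing else. *)
Lemma subsums_rem a s : zsum_free s -> a \in s ->
  (#|subsums s| <= #|subsums (rem a s)|.+1)%N ->
  subsums (rem a s) = (subsums s :\ \sum_(c <- s) c)%SET.
Proof.
move=> z as_ card; have sE := perm_to_rem as_.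
have z' := zsum_free_perm sE z.
have XE : subsums s = subsums (a :: rem a s) by exact: subsums_perm.
have sN : \sum_(c <- s) c \notin subsums (rem a s).
  rewrite -subsums_sym (perm_big _ sE) big_cons opprD addrCA subrr addr0.
  exact: zsum_free_opp z'.
apply/eqP; rewrite eqEcard; apply/andP; split.
  apply/fintype.subsetP => x xX; rewrite finset.in_setD1 XE sub_subsums_cons// andbT.
  by apply: contraNneq sN => <-.
have sX : \sum_(c <- s) c \in subsums s.
  by rewrite -subsums_sym subrr subsums0.
by move: card; rewrite (cardsD1 (\sum_(c <- s) c) (subsums s)) sX add1n ltnS.
Qed.

Lemma behaving_nseq l b : zsum_free (nseq l b) -> behaving (nseq l b).
Proof.
move=> z; exists b, (nseq l 0%N); rewrite sumn_nseq mul0n add0n size_nseq; split.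
- by rewrite map_nseq mulr1n.
- rewrite ltnNge; apply/negP => le.
  have /z/= : perm_eq (nseq #[b]%g b ++ nseq (l - #[b]%g) b) (nseq l b).
    by rewrite -nseqD subnKC.
  rewrite big_nseq iter_addr_0 mulrn_order => /(_ erefl).
  by have := order_gt0 b; case: #[b]%g.
- move=> i il; apply/subsumsP; exists (nseq i b), (nseq (l - i) b).
  rewrite -nseqD subnKC//; split=> //.
  by rewrite big_nseq iter_addr_0.
Qed.

(* All s minus one term have the same subsums X, namely those of s except the
   total sg. Adding multiples of a term b to an element of X stays in X until sg
   is hit, while - c is never in X for a term c; this forces c = b. *)
Lemma behaving_tight s : zsum_free s -> s != [::] ->
  (forall a, a \in s -> (#|subsums s| <= #|subsums (rem a s)|.+1)%N) ->
  behaving s.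
Proof.
move=> z s0 tight; set sg := \sum_(c <- s) c.
have remE a : a \in s -> subsums (rem a s) = (subsums s :\ sg)%SET.
  by move=> as_; apply: subsums_rem => //; exact: tight.
set X := (subsums s :\ sg)%SET in remE.
have NX a : a \in s -> - a \notin X.
  move=> as_; rewrite -(remE a as_); apply: zsum_free_opp.
  exact: zsum_free_perm (perm_to_rem as_) z.
(* By [remE], [x] is the sum of a subsequence that leaves out a copy of [a], so [x + a] is still a
   subsum of [s]. *)
have step a x : a \in s -> x \in X -> x + a != sg -> x + a \in X.
  move=> as_ xX ne; rewrite finset.in_setD1 ne/= (subsums_perm (perm_to_rem as_)).
  by rewrite subsums_cons orbC addrK remE// xX.
have walk b x j : b \in s -> x \in X ->
    (forall i, (i <= j)%N -> x + b *+ i != sg) -> x + b *+ j \in X.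
  move=> bs xX; elim: j => [|j IH] ne; first by rewrite mulr0n addr0.
  rewrite mulrSr addrA; apply: step => //; last by rewrite -addrA -mulrSr ne.
  by apply: IH => i ij; apply: ne; lia.
have X0 : 0 \in X.
  rewrite finset.in_setD1 subsums0 andbT; apply: contra s0 => /eqP sg0.
  by apply/eqP; apply: (z s [::]); rewrite ?cats0.
have [b bs] : exists b, b \in s 
  by case: (s) s0 => // b s' _; exists b; rewrite mem_head.
have Ngt0 := order_gt0 b; set N := #[b]%g in Ngt0.
(* The walk from [0] by steps of [b] meets [sg] no later than at [- b = b *+ (N - 1)], since [NX]
   keeps [- b] out of [X]. *)
have [M [MN sgE Mmin]] : exists M, [/\ (M < N)%N, sg = b *+ M &
    forall j, (j < M)%N -> b *+ j \in X].
  have [[M MN sgE]|noM] := pselect (exists2 M, (M < N)%N & sg = b *+ M).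
    exists M; split=> // j jM; rewrite -[_ *+ _]add0r; apply: walk => // i ij.
    by rewrite add0r sgE; apply: mulrn_neq_lt; lia.
  case/negP: (NX b bs); rewrite -[b in - b]mulr1n opp_mulrn// -[_ *+ _]add0r.
  apply: walk => // i iN; apply/eqP => iE; apply: noM; exists i; first by lia.
  by rewrite -iE add0r.
suff alleq c : c \in s -> c = b.
  have sE : s = nseq (size s) b.
    by apply/all_pred1P/allP => c /alleq ->; rewrite /= eqxx.
  by rewrite sE; apply: behaving_nseq; rewrite -sE.
move=> cs; apply/eqP/negP => /negP cb.
have cX : c \in X.
  rewrite -(remE b bs); apply: mem_subsums.
  have := cs; rewrite (perm_mem (perm_to_rem bs)) inE.
  by rewrite (negPf cb).
have c0 := zsum_free_neq0 z cs.
have [[i iN cE]|noc] := pselect (exists2 i, (i < N)%N & c = b *+ i); last first.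
  (* If [c] is not a multiple of [b], the walk from [sg - c] never meets [sg], yet reaches [- c]
     after [N - M] steps. *)
  have scX : sg - c \in X.
    rewrite finset.in_setD1 subsums_sym.
    rewrite (mem_subsums cs) andbT; apply: contra c0 => /eqP.
    by rewrite -[RHS]subr0 => /addrI/eqP; rewrite eqr_opp.
  case/negP: (NX c cs).
  have -> : - c = (sg - c) + b *+ (N - M).
    by rewrite addrAC sgE -mulrnDr subnKC ?(ltnW MN)// mulrn_order sub0r.
  apply: walk => // i iNM; apply/eqP => iE; apply: noc; exists (i %% N)%N.
    by rewrite ltn_mod.
  have -> : b *+ (i %% N) = b *+ i by apply/eqP; rewrite eq_mulrn_mod modn_mod.
  by apply/eqP; rewrite -(inj_eq (addrI (sg - c))) iE subrK.
(* From a multiple of [b] in [X] lying beyond [sg = b *+ M], the walk would reach [- b] without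
   meeting [sg]. *)
have XM j : (j < N)%N -> b *+ j \in X -> (j < M)%N.
  move=> jN jX; rewrite ltnNge; apply/negP => Mj.
  have Mj' : M != j.
    by apply/eqP => Mj'; move: jX; rewrite finset.in_setD1 sgE Mj' eqxx.
  case/negP: (NX b bs); rewrite -[b in - b]mulr1n opp_mulrn//.
  have -> : (N - 1 = j + (N - 1 - j))%N by lia.
  rewrite mulrnDr; apply: walk => // i' i'N.
  by rewrite sgE -mulrnDr; apply: mulrn_neq_lt; lia.
have iM : (i < M)%N by apply: XM => //; rewrite -cE.
have i0 : i != 0%N by apply: contra c0 => /eqP i0; rewrite cE i0.
have i1 : i != 1%N by apply: contra cb => /eqP i1; rewrite cE i1.
(* Here [1 < i < M]. Adding [c = b *+ i] to this element jumps over [sg] to [b *+ M.+1], against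
   [XM]; if [M.+1 = N], the element is [- c] itself, against [NX]. *)
have xX : b *+ (M.+1 - i) \in X by apply: Mmin; lia.
have [MN'|MN'] := eqVneq M.+1 N.
  by move: (NX c cs); rewrite cE opp_mulrn -/N ?(ltnW iN)// -MN' xX.
suff /XM : b *+ M.+1 \in X by lia.
have -> : b *+ M.+1 = b *+ (M.+1 - i) + c by rewrite cE -mulrnDr subnK//; lia.
by apply: step => //; rewrite sgE cE -mulrnDr; apply: mulrn_neq_lt; lia.
Qed.

(** A bound on the number of subsums replaces [2 l > |G|] because it is inherited: removing a term
    that loses at least two subsums preserves it, and [behaving_cons] restores the term. If there is
    no such term, [behaving_tight] applies. *)
Theorem savchev_chen s : zsum_free s -> (#|subsums s| < 2 * size s)%N -> behaving s.
Proof.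
have [l sl] := ubnP (size s); elim: l s sl => // l IH s sl z card.
have [[a as_ lt]|tight] := pselect (exists2 a, a \in s &
    (#|subsums (rem a s)|.+1 < #|subsums s|)%N).
  have sE := perm_to_rem as_.
  have ss : size s = (size (rem a s)).+1 by rewrite (perm_size sE).
  rewrite perm_sym in sE; apply: (behaving_perm sE); rewrite perm_sym in sE.
  have z' := zsum_free_perm sE z.
  apply: behaving_cons => //; last by rewrite -(subsums_perm sE) -ss.
  apply: IH; [by move: sl; rewrite ss|exact: zsum_free_behead z'|].
  by have := leq_ltn_trans lt card; rewrite ss mulnS add2n !ltnS.
apply: behaving_tight => //; first by case: s card {sl z tight} => //; rewrite muln0.
by move=> a as_; rewrite leqNgt; apply/negP => lt; apply: tight; exists a.
Qed.

End Subsums.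

(** * Partitions *)

Lemma leq_mem_sumn (s : seq nat) x : x \in s -> (x <= sumn s)%N.
Proof. by elim: s => //= a s IH; rewrite inE => /orP[/eqP->|/IH]; lia. Qed.

Lemma size_leq_sumn_pos (t : seq nat) : 0%N \notin t -> (size t <= sumn t)%N.
Proof.
by elim: t => // a t IH; rewrite inE negb_or => /andP[a0 /IH] /=; lia.
Qed.

Definition bounded_seqs (k : nat) (Q : pred (seq nat)) : seq (seq nat) :=
  [seq s <- [seq [seq val i | i <- t]
              | t : {bseq k of 'I_k.+1} <- enum {: {bseq k of 'I_k.+1}}]
     | Q s].

Lemma bounded_seqs_uniq k Q : uniq (bounded_seqs k Q).
Proof.
apply: filter_uniq; rewrite map_inj_uniq ?enum_uniq// => t u tu.
exact/val_inj/(inj_map val_inj).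
Qed.

(** The bounds in the type exclude nothing: positive entries with sum at most [k] are at most [k] in
    number and in size. *)
Lemma mem_bounded_seqs k (Q : pred (seq nat)) s :
  (Q s -> (0%N \notin s) && (sumn s <= k)%N) -> (s \in bounded_seqs k Q) = Q s.
Proof.
move=> Qk; rewrite mem_filter; apply: andb_idr => /Qk/andP[s0 sk].
have sz : (size [seq inord i : 'I_k.+1 | i <- s] <= k)%N.
  by rewrite size_map; apply: leq_trans sk; apply: size_leq_sumn_pos.
apply/mapP; exists (Bseq sz); first by rewrite mem_enum.
rewrite /= -map_comp -[LHS]map_id; apply/eq_in_map => x xs /=.
by rewrite inordK// ltnS (leq_trans (leq_mem_sumn xs)).
Qed.

Definition partitions_upto (k : nat) : seq (seq nat) :=
  bounded_seqs k (fun s => [&& sorted leq s, 0%N \notin s & sumn s <= k])%N.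

Lemma mem_partitions_upto k s : (s \in partitions_upto k) =
  [&& sorted leq s, 0%N \notin s & sumn s <= k]%N.
Proof. by rewrite mem_bounded_seqs// => /and3P[_ -> ->]. Qed.

(** This puts the partitions of all [j <= k] into one list independent of [j], over which sums can
    be exchanged. *)
Lemma num_partitionsE k j d : (j <= k)%N -> num_partitions j d =
  count (fun s => (sumn s == j) && (size (undup s) == d)) (partitions_upto k).
Proof.
move=> jk; set Q := fun s : seq nat =>
  [&& sorted leq s, 0%N \notin s, sumn s == j & size (undup s) == d].
have -> : num_partitions j d = size (bounded_seqs j Q).
  rewrite size_filter count_map /num_partitions cardE.
  rewrite -size_filter /enum_mem -filter_predI.
  congr size; apply: eq_filter => t /=.
  by rewrite !inE andbT.
rewrite -size_filter; apply/perm_size/uniq_perm.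
- exact: bounded_seqs_uniq.
- exact/filter_uniq/bounded_seqs_uniq.
move=> s; rewrite mem_bounded_seqs; last first.
  by move=> /and4P[_ -> /eqP-> _]; rewrite leqnn.
rewrite mem_filter mem_partitions_upto /Q.
case: eqP => [->|_]; rewrite ?andbF// jk.
by case: sorted; case: (_ \in _); case: eqP.
Qed.

(** The least possible sum is [1 + ... + size u]. By pigeonhole some entry is at least [size u]; the
    induction removes it. *)
Lemma uniq_sumn_lower (u : seq nat) : uniq u -> 0%N \notin u ->
  (size u * (size u).+1 <= 2 * sumn u)%N.
Proof.
have [m] := ubnP (size u); elim: m u => // m IH u um uu u0.
have [->//|un] := eqVneq u [::].
have [x xu xs] : exists2 x, x \in u & (size u <= x)%N.
  apply/hasP; apply: contraT => /hasPn no.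
  have /(uniq_leq_size uu) : {subset u <= iota 1 (size u).-1}.
    move=> x xu; rewrite mem_iota; have := no x xu; rewrite -ltnNge.
    have : x != 0%N by apply: contraNneq u0 => <-.
    by lia.
  by rewrite size_iota; case: (u) un => //= *; lia.
have uE := perm_to_rem xu.
have sE : sumn u = (x + sumn (rem x u))%N by rewrite !sumnE (perm_big _ uE) big_cons.
have zE : size u = (size (rem x u)).+1 by rewrite (perm_size uE).
have := IH (rem x u); rewrite rem_uniq// => /(_ _ erefl) H.
have : (size (rem x u) < m)%N by lia.
have r0 : 0%N \notin rem x u by apply: contra u0; exact: mem_rem.
move=> /H/(_ r0).
rewrite zE in xs *; rewrite sE; move: xs; move: (size _) (sumn _) => a b; nia.
Qed.

Lemma sumn_undup (s : seq nat) : (sumn (undup s) <= sumn s)%N.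
Proof. by elim: s => //= a s IH; case: ifP => _ /=; lia. Qed.

(** Partitions are grouped by their number [e = d - 1] of distinct parts. The summation limits omit
    only zero terms, since [e] distinct parts force [e (e + 1) / 2 <= j <= k]. *)
Lemma partition_weight_sum (R : realType) (k : nat) (p : R) :
  let D : nat := Num.truncn ((1 + Num.sqrt (1 + 8 * k%:R)) / 2 : R) in
  p + \sum_(2 <= d < D.+1) p ^+ d *
             (\sum_(((d - 1) * d) %/ 2 <= j < k.+1)
                num_partitions j (d - 1))%N%:R =
  \sum_(s <- partitions_upto k) p ^+ (size (undup s)).+1.
Proof.
move=> D.
have low s : s \in partitions_upto k ->
    ((size (undup s) * (size (undup s)).+1) %/ 2 <= sumn s <= k)%N.
  rewrite mem_partitions_upto => /and3P[_ s0 ->]; rewrite andbT.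
  have := uniq_sumn_lower (undup_uniq s); rewrite mem_undup => /(_ s0) le.
  apply: leq_trans (sumn_undup s).
  by rewrite -[leqRHS](@mulKn _ 2)//; apply: leq_div2r.
have sD s : s \in partitions_upto k -> (size (undup s) < D)%N.
  move=> /low; set e := size (undup s) => ek.
  have ek' : (e * e.+1 <= 2 * k)%N.
    have : (2 %| e * e.+1)%N by rewrite dvdn2 oddM/= andbN.
    by move=> /dvdnP[q qE]; move: ek; rewrite qE mulnK//; lia.
  rewrite /D truncn_ge_nat; last first.
    by rewrite divr_ge0// addr_ge0// sqrtr_ge0.
  rewrite ler_pdivlMr// -lerBlDl.
  (* The claim [e < D] becomes [(2 e + 1)^2 <= 1 + 8 k], equivalent to [e (e + 1) <= 2 k]. *)
  have -> : (e.+1%:R * 2 - 1 : R) = Num.sqrt ((2 * e + 1)%N%:R ^+ 2).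
    by rewrite sqrtr_sqr ger0_norm ?ler0n// natrD natrM -[e.+1]addn1 natrD; lra.
  rewrite ler_sqrt; last by rewrite addr_ge0// mulr_ge0.
  by rewrite -natrX -natrM -(natrD _ 1) ler_nat; move: (e) ek' => a; nia.
have D1 : (1 < D.+1)%N by have := sD [::]; rewrite mem_partitions_upto => /(_ erefl).
transitivity (\sum_(1 <= d < D.+1) p ^+ d *
    (count (fun s => size (undup s) == (d - 1)%N) (partitions_upto k))%:R).
  rewrite [RHS]big_ltn//; congr (_ + _).
    (* For [d = 1] only the empty partition is counted; it accounts for the isolated [p]. *)
    rewrite subnn expr1.
    suff -> : count (fun s : seq nat => size (undup s) == 0%N)
        (partitions_upto k) = 1%N by rewrite mulr1.
    have eq0 (s : seq nat) : (size (undup s) == 0%N) = (s == [::]).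
      by rewrite size_eq0; apply/eqP/eqP => [/undup_nil|->].
    rewrite (eq_count eq0) count_uniq_mem ?bounded_seqs_uniq//.
    by rewrite mem_partitions_upto.
  apply: eq_big_nat => d /andP[d2 dD]; congr (_ * _%:R).
  transitivity (\sum_(((d - 1) * d) %/ 2 <= j < k.+1)
      count (fun s => (sumn s == j) && (size (undup s) == d - 1)%N)
        (partitions_upto k))%N.
    by apply: eq_big_nat => j /andP[_ jk]; apply: num_partitionsE.
  under eq_bigr do rewrite -sum1_count big_mkcond.
  rewrite exchange_big/= -sum1_count [RHS]big_mkcond/= big_seq [RHS]big_seq.
  apply: eq_bigr => s /low/andP[sl sk].
  case: eqP => [sd|_]; last by rewrite big1// => j _; rewrite andbF.
  under eq_bigr do rewrite andbT.
  rewrite -big_mkcond/=; under eq_bigl do rewrite eq_sym.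
  rewrite big_nat1_eq.
  have d1 : (d - 1).+1 = d by lia.
  by rewrite sd d1 in sl; rewrite ltnS sk sl.
under eq_bigr do rewrite -sum1_count natr_sum mulr_sumr big_mkcond.
rewrite exchange_big/= big_seq [RHS]big_seq; apply: eq_bigr => s /sD sd.
transitivity (\sum_(1 <= d < D.+1 | d == (size (undup s)).+1) p ^+ d).
  rewrite [RHS]big_mkcond; apply: eq_big_nat => d /andP[d1 _]; rewrite mulr1.
  by have -> : (size (undup s) == (d - 1)%N) = (d == (size (undup s)).+1) by lia.
by rewrite big_nat1_eq/= ltnS sd.
Qed.

(** * Zero-sum free sequences of length n - 1 - k *)

(** Discrete logarithm to base [g], with default value [#[g]%g] outside the multiples of [g]. *)
Definition dlog (G : finZmodType) (g a : G) : nat :=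
  index a [seq g *+ i | i <- iota 0 #[g]%g].

Lemma dlogK (G : finZmodType) (g : G) i : (i < #[g]%g)%N -> dlog g (g *+ i) = i.
Proof.
move=> iN; rewrite /dlog.
have szE : size [seq g *+ i | i <- iota 0 #[g]%g] = #[g]%g by rewrite size_map size_iota.
have <- : nth 0 [seq g *+ i | i <- iota 0 #[g]%g] i = g *+ i.
  by rewrite (nth_map 0%N) ?size_iota// nth_iota.
rewrite index_uniq ?szE// map_inj_in_uniq ?iota_uniq// => x y.
rewrite !mem_iota add0n => xN yN; exact: mulrn_inj_lt.
Qed.

Lemma size_leq_sumn (s : seq nat) : (size s <= count_mem 0%N s + sumn s)%N.
Proof. by elim: s => //= -[|a] s; rewrite ?eqxx /=; lia. Qed.

Lemma count_mul_leq_sumn (s : seq nat) x : (x * count_mem x s <= sumn s)%N.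
Proof.
elim: s => [|a s IH]; first by rewrite muln0.
by rewrite /= mulnDr leq_add//; case: eqVneq => [->|_]; rewrite ?muln1 ?muln0.
Qed.

(** The logarithms of all terms add up to less than [#[g]%g], so those of a zero-sum subsequence add
    up to [0], although each is positive. *)
Lemma zsum_free_multiples (G : finZmodType) (g : G) (ys : seq nat) :
  (sumn ys + size ys < #[g]%g)%N -> zsum_free [seq g *+ y.+1 | y <- ys].
Proof.
move=> lt t u tu t0.
have ysN y : y \in ys -> (y.+1 < #[g]%g)%N.
  move=> yy; have := leq_mem_sumn yy.
  have : (0 < size ys)%N by case: (ys) yy.
  by lia.
have tE a : a \in t ++ u -> exists2 y, a = g *+ y.+1 & (y.+1 < #[g]%g)%N.
  by rewrite (perm_mem tu) => /mapP[y /ysN yN ->]; exists y.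
have sumE : (\sum_(a <- t ++ u) dlog g a = sumn ys + size ys)%N.
  rewrite (perm_big _ tu) big_map big_seq.
  under eq_bigr => y yy do rewrite dlogK ?ysN// -addn1.
  by rewrite -big_seq big_split/= sum1_size sumnE.
have : g *+ (\sum_(a <- t) dlog g a) = 0.
  rewrite -[RHS]t0 -sumrMnr big_seq [RHS]big_seq; apply: eq_bigr => a at_.
  have [|y -> yN] := tE a; first by rewrite mem_cat at_.
  by rewrite dlogK.
move: sumE; rewrite big_cat/= => sumE /eqP.
rewrite -[0](mulr0n g) eq_mulrn_mod mod0n modn_small; last by lia.
case: t tE {tu t0 sumE} => // a t tE; rewrite big_cons.
have [|y -> yN] := tE a; first by rewrite mem_cat mem_head.
by rewrite dlogK.
Qed.

Lemma perm_multiples (G : finZmodType) (g : G) (ys zs : seq nat) :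
  (sumn ys + size ys < #[g]%g)%N -> (sumn zs + size zs < #[g]%g)%N ->
  perm_eq [seq g *+ y.+1 | y <- ys] [seq g *+ y.+1 | y <- zs] -> perm_eq ys zs.
Proof.
have H xs : (sumn xs + size xs < #[g]%g)%N ->
    [seq (dlog g a).-1 | a <- [seq g *+ y.+1 | y <- xs]] = xs.
  move=> lt; rewrite -map_comp -[RHS]map_id; apply/eq_in_map => x xx /=.
  rewrite dlogK//; have := leq_mem_sumn xx.
  have : (0 < size xs)%N by case: (xs) xx.
  lia.
by move=> /H{2}<- /H{2}<-; apply: perm_map.
Qed.

Lemma order2_Z4 (n : nat) (c : 'Z_n) : n = 4%N -> c *+ 2 = 0 -> c != 0 -> c = 2%:R.
Proof.
move=> n4; subst n => c2 c0; apply/eqP; move: c2 c0 => /eqP.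
by case: c => [[|[|[|[|//]]]] i].
Qed.

(** * Structure over [C_n] and uniqueness of the generator *)

Section Zn.
Variables (n k : nat).
Hypotheses (hn : (2 <= n)%N) (hk : (k <= n %/ 3)%N).

Lemma card_Zn : #|'Z_n| = n.
Proof. by rewrite card_ord Zp_cast. Qed.

Lemma generatorE (g : 'Z_n) : generator [set: 'Z_n]%SET g = (#[g]%g == n).
Proof.
rewrite /generator eq_sym eqEcard finset.subsetT/= finset.cardsT card_Zn.
by rewrite eqn_leq [X in _ = X && _](_ : _ = true)// -[X in (_ <= X)%N]card_Zn max_card.
Qed.

Hypotheses (h31 : (n, k) <> (3%N, 1%N)) (h62 : (n, k) <> (6%N, 2%N)).

Let h31' : ~~ ((n == 3%N) && (k == 1%N)).
Proof. by apply/negP => /andP[/eqP nE /eqP kE]; apply: h31; rewrite nE kE. Qed.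

Let h62' : ~~ ((n == 6%N) && (k == 2%N)).
Proof. by apply/negP => /andP[/eqP nE /eqP kE]; apply: h62; rewrite nE kE. Qed.

(* Both sequences have few terms other than their generator, so g' occurs at
   least n - 1 - 2 k times in the first one, each time as g *+ x.+1. *)
Lemma mult_bound (g g' : 'Z_n) ys zs :
  #[g]%g = n -> size ys = (n - 1 - k)%N -> (sumn ys <= k)%N ->
  size zs = (n - 1 - k)%N -> (sumn zs <= k)%N ->
  perm_eq [seq g *+ y.+1 | y <- ys] [seq g' *+ y.+1 | y <- zs] ->
  exists2 x, g' = g *+ x.+1 & (x * (n - 1 - 2 * k) <= k)%N.
Proof.
move=> gn sy ky sz kz yz.
have c1 : (n - 1 - 2 * k <= count_mem g' [seq g' *+ y.+1 | y <- zs])%N.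
  rewrite count_map; apply: leq_trans (sub_count (a1 := pred1 0%N) _ zs).
    by have := size_leq_sumn zs; lia.
  by move=> y /eqP->/=; rewrite mulr1n.
(* The bound in [c1] is positive because [(3, 1)] is excluded, so [g'] does occur. *)
have : g' \in [seq g *+ y.+1 | y <- ys].
  by rewrite (perm_mem yz) -has_pred1 has_count; apply: leq_trans c1; lia.
case/mapP => x xy g'E; exists x => //.
apply: leq_trans (leq_trans (count_mul_leq_sumn ys x) ky).
rewrite leq_mul2l; apply/orP; right; apply: leq_trans c1 _.
rewrite -(seq.permP yz) count_map; apply/eq_leq/eq_in_count => y yy /=.
have := leq_mem_sumn yy; have := leq_mem_sumn xy => xk yk.
rewrite g'E; apply/eqP/eqP => [|->//] /mulrn_inj_lt.
rewrite gn => H; suff : y.+1 = x.+1 by lia. 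
apply: H; lia.
Qed.

(** As [2 (n - 1 - 2 k) > k] outside [(3, 1)] and [(6, 2)], [mult_bound] leaves only [g' = g *+ 2]
    and [g = g' *+ 2] when [g] and [g'] differ. Then [g *+ 3 = 0], so [n = 3] and [k = 0], which the
    bound rules out. *)
Lemma generator_unique (g g' : 'Z_n) ys zs :
  #[g]%g = n -> #[g']%g = n ->
  size ys = (n - 1 - k)%N -> (sumn ys <= k)%N ->
  size zs = (n - 1 - k)%N -> (sumn zs <= k)%N ->
  perm_eq [seq g *+ y.+1 | y <- ys] [seq g' *+ y.+1 | y <- zs] -> g = g'.
Proof.
move=> gn g'n sy ky sz kz yz.
have [x g'E xk] := mult_bound gn sy ky sz kz yz.
rewrite perm_sym in yz.
have [x' gE x'k] := mult_bound g'n sz kz sy ky yz.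
have [x0|x0] := posnP x; first by rewrite g'E x0 mulr1n.
have [x'0|x'0] := posnP x'; first by rewrite gE x'0 mulr1n.
have x1 : x = 1%N by nia.
have x'1 : x' = 1%N by nia.
have : g *+ 4 == g *+ 1 by rewrite mulr1n {2}gE g'E x1 x'1 -mulrnA.
rewrite eq_mulrn_mod gn => n3.
have n4 : n = 3%N.
  have [n5|n5] := ltnP 4 n; first by move: n3; rewrite !modn_small//; lia.
  by move: n3; case: (n) hn n5 => [|[|[|[|[|]]]]].
nia.
Qed.

Lemma order_dvd_n (g : 'Z_n) : (#[g]%g %| n)%N.
Proof.
by rewrite -[X in (_ %| X)%N]card_Zn -finset.cardsT order_dvdG ?finset.inE.
Qed.

(** For the case [(4, 1)]: [a] has order 4, and [b = a *+ i] with [i] equal to 1 or 2, because 0 and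
    3 would give [b = 0] and [a + b = 0]. *)
Lemma order4 (a b : 'Z_n) : n = 4%N -> a *+ 2 != 0 -> b != 0 -> a + b != 0 ->
  exists g ys, [/\ #[g : 'Z_n]%g = n, [:: a; b] = [seq g *+ y.+1 | y <- ys]
    & (sumn ys <= 1)%N].
Proof.
move=> n4 a2 b0 ab0.
have an : #[a]%g = 4%N.
  have : (#[a]%g %| 4)%N by rewrite -[X in (_ %| X)%N]n4 order_dvd_n.
  move: a2; rewrite -[0](mulr0n a) eq_mulrn_mod mod0n => a2 d4.
  have lt04 : (0 < 4)%N by [].
  move: (dvdn_leq lt04 d4) (d4) a2 (order_gt0 a).
  by case: #[a]%g => [|[|[|[|[|]]]]].
have : b \in <[a]>%g.
  suff -> : <[a]>%g = [set: 'Z_n]%SET by rewrite finset.inE.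
  apply/eqP; rewrite eqEcard finset.subsetT/= finset.cardsT card_Zn.
  by rewrite [X in (X <= _)%N]n4 -an.
case/cyclePmin => i; rewrite an FinRing.zmodXgE => i4 bE.
exists a, [:: 0%N; i.-1]; split => /=; first by rewrite an.
  by congr [:: _; _]; case: i bE {i4} => // bE; rewrite bE eqxx in b0.
suff : i != 3%N by lia.
apply: contra ab0 => /eqP i3.
by rewrite bE i3 -mulrS -[4%N]an mulrn_order.
Qed.

Lemma zsum_free_structure (s : seq 'Z_n) : size s = (n - 1 - k)%N -> zsum_free s ->
  exists g ys, [/\ #[g : 'Z_n]%g = n, perm_eq s [seq g *+ y.+1 | y <- ys]
    & (sumn ys <= k)%N].
Proof.
move=> ss z.
(* When [2 l > n], the trivial bound [n] on the number of subsums suffices for [savchev_chen]. *)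
have [lt|le] := ltnP n (2 * size s).
  have [b [ys [sE lt']]] : exists (b : 'Z_n) ys,
      perm_eq s [seq b *+ y.+1 | y <- ys] /\ (sumn ys + size ys < #[b]%g)%N.
    have [|b [ys [sE lt' _]]] := savchev_chen z; last by exists b, ys.
    by apply: leq_ltn_trans lt; rewrite -[X in (_ <= X)%N]card_Zn max_card.
  have sy : size s = size ys by rewrite (perm_size sE) size_map.
  (* The order of [b] divides [n] and exceeds [size s], which is more than half of [n]. *)
  have bn : #[b]%g = n.
    case/dvdnP: (order_dvd_n b) => -[|[|q]]; rewrite ?mul1n// ?mul0n => nE.
      by exfalso; lia.
    by exfalso; move: nE; rewrite !mulSn; lia.
  by exists b, ys; split => //; lia.
have [[n2 k0]|[n4 k1]] : (n = 2 /\ k = 0)%N \/ (n = 4 /\ k = 1)%N.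
  by rewrite ss in le; have h1 := h31'; have h2 := h62'; clear h31 h62 z ss; lia.
  have s1 : size s = 1%N by rewrite ss; lia.
  case: s s1 z {ss le} => [|a [|//]] // _ z.
  have a0 : a != 0 by apply: (zsum_free_neq0 z); rewrite mem_head.
  exists a, [:: 0%N]; split=> //; rewrite [RHS]n2.
  have ad : (#[a]%g %| 2)%N by rewrite -[X in (_ %| X)%N]n2 order_dvd_n.
  have /eqP-> // : #[a]%g == 2%N.
  have/primeP[_ /(_ _ ad)/orP[|//]] : prime 2 by [].
  by rewrite order_eq1 (negPf a0).
have s2 : size s = 2%N by rewrite ss; lia.
case: s s2 z {ss le} => [|a [|b [|//]]] // _ z; rewrite k1.
have a0 : a != 0 by apply: (zsum_free_neq0 z); rewrite !inE eqxx.
have b0 : b != 0 by apply: (zsum_free_neq0 z); rewrite !inE eqxx orbT.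
have ab0 : a + b != 0.
  apply/eqP => ab0.
  have /(z [:: a; b] [::]) : perm_eq ([:: a; b] ++ [::]) [:: a; b] by [].
  by rewrite big_cons big_seq1 => /(_ ab0).
have [a2|a2] := eqVneq (a *+ 2) 0; last first.
  have [g [ys [gn gE yk]]] := order4 n4 a2 b0 ab0.
  by exists g, ys; rewrite -gE.
have [b2|b2] := eqVneq (b *+ 2) 0; last first.
  rewrite addrC in ab0.
  have [g [ys [gn gE yk]]] := order4 n4 b2 a0 ab0.
  by exists g, ys; rewrite -gE; split => //; rewrite (perm_catC [:: a] [:: b]).
(* Both terms now have order 2 in [C_4], so they coincide and their sum is zero. *)
case/eqP: ab0; have aE := order2_Z4 n4 a2 a0; have bE := order2_Z4 n4 b2 b0.
by rewrite {1}aE -bE -mulr2n.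
Qed.

End Zn.

(** * Counting and expectation *)

(** Linearity of expectation: the count is a sum of indicators of the events [E i], each an
    intersection of [#|A i|] independent events of probability [p]. *)
Lemma expectation_count_subset (d : measure_display) (W : measurableType d)
    (R : realType) (P : probability W R) (T : finType) (p : R)
    (X : W -> {set T}) (I : Type) (L : seq I) (A : I -> {set T}) :
  random_subset P p X ->
  ('E_P[fun w => (count (fun i => A i \subset X w) L)%:R : R] =
    (\sum_(i <- L) p ^+ #|A i|)%:E)%E.
Proof.
case=> mX PX indX.
pose E i := (\bigcap_(a in [set` A i]) [set w | a \in X w])%classic.
have EE i w : w \in E i = (A i \subset X w).
  apply/idP/fintype.subsetP => [|sub].
    by rewrite inE => Ew a aA; apply: Ew.
  by rewrite inE => a /= aA; apply: sub.
have mE i : measurable (E i) by apply: fin_bigcap_measurable.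
have PE i : P (E i) = (p ^+ #|A i|)%:E.
  by rewrite indX (eq_bigr (fun=> p%:E)) // prodEFin prodr_const.
rewrite unlock.
under eq_integral => w _.
  rewrite -sum1_count natr_sum big_mkcond/= -sumEFin.
  under eq_bigr => i _.
    rewrite (_ : (if _ then _ else _) = \1_(E i) w); last first.
      by rewrite indicE EE; case: ifP.
    over.
  over.
rewrite ge0_integral_sum//=; last first.
  by move=> i; exact/measurable_EFinP/measurable_indic.
by rewrite -sumEFin; apply: eq_bigr => i _; rewrite integral_indic// setIT; exact: PE.
Qed.

(** * Passing between multisets and lists *)

Lemma zero_sum_free_seq_mset n (s : seq 'Z_n) :
  zero_sum_free (seq_mset s) <-> zsum_free s.
Proof.
split=> [z t u tu t0|z T /msubsetP TS T0].
  apply/eqP/negPn/negP => tn.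
  have tS : (seq_mset t `<=` seq_mset s)%mset.
    by apply/msubsetP => x; rewrite !mset_seqE -(seq.permP tu) count_cat leq_addr.
  have tn0 : seq_mset t != mset0.
    apply: contra tn => /eqP tE; apply/eqP/perm_nilP.
    by rewrite -(permPl (perm_eq_seq_mset t)) tE enum_mset0.
  by have := z _ tS tn0; rewrite /zero_sum (perm_big _ (perm_eq_seq_mset t)) t0 eqxx.
apply: contra T0 => /eqP T0.
(* The multiset difference supplies the complement required by [zsum_free]. *)
have TE : perm_eq (T ++ (seq_mset s `\` T)%mset) s.
  apply/allP => x _ /=; rewrite count_cat !count_mem_mset msetE2 mset_seqE.
  by have := TS x; rewrite mset_seqE => /subnKC->.
have := z _ _ TE T0; rewrite -{2}[T]seq_mset_id => ->.
by apply/eqP/msetP => x; rewrite mset_seqE mset0E.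
Qed.

Lemma contained_seq_mset n (s : seq 'Z_n) (A : {set 'Z_n}) :
  contained (seq_mset s) A <-> [set x in s]%SET \subset A.
Proof.
have sE x : (x \in seq_mset s) = (x \in s) := perm_mem (perm_eq_seq_mset s) x.
split=> [c|/fintype.subsetP c a].
  by apply/fintype.subsetP => x; rewrite finset.inE -sE; apply: c.
by rewrite sE => as_; apply: c; rewrite finset.inE.
Qed.

Lemma perm_filter_neq0 (s : seq nat) :
  perm_eq s ([seq y <- s | y != 0%N] ++ nseq (count_mem 0%N s) 0%N).
Proof.
rewrite -(perm_filterC (fun y => y != 0%N) s) perm_cat2l.
have -> : [seq x <- s | predC (fun y => y != 0%N) x] = [seq y <- s | pred1 0%N y].
  by apply: eq_filter => y /=; rewrite negbK.
by rewrite -size_filter; have /all_pred1P <- := filter_all (pred1 0%N) s.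
Qed.

(** * The bijection with pairs of a generator and a partition *)

Section Counting.
Variables (n k : nat).
Hypotheses (hn : (2 <= n)%N) (hk : (k <= n %/ 3)%N).
Hypotheses (h31 : (n, k) <> (3%N, 1%N)) (h62 : (n, k) <> (6%N, 2%N)).

Let l := (n - 1 - k)%N.

(** A partition of some [j <= k] has at most [k] parts, so padding it to length [l] adds at least
    one zero: the generator itself is a term. *)
Let kl : (k < l)%N.
Proof.
have : ~~ ((n == 3%N) && (k == 1%N)).
  by apply/negP => /andP[/eqP nE /eqP kE]; apply: h31; rewrite nE kE.
rewrite /l; lia.
Qed.

Let kln : (k + l < n)%N.
Proof. by move: kl; rewrite /l; lia. Qed.

Definition padded_multiples (i : 'Z_n * seq nat) : seq 'Z_n :=
  [seq i.1 *+ y.+1 | y <- i.2 ++ nseq (l - size i.2) 0%N].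

Definition generator_partition_pairs : seq ('Z_n * seq nat) :=
  [seq (g, t) | g <- enum [set g : 'Z_n | generator [set: 'Z_n]%SET g]%SET,
                t <- partitions_upto k].

Lemma generator_partition_pairsP i :
  reflect [/\ #[i.1]%g = n, sorted leq i.2, 0%N \notin i.2 & (sumn i.2 <= k)%N]
          (i \in generator_partition_pairs).
Proof.
apply: (iffP allpairsP) => [[[g t] [/= gn tk ->]]|].
  move: gn tk; rewrite mem_enum finset.inE generatorE// mem_partitions_upto.
  by move=> /eqP-> /and3P[].
case: i => g t /= [gn st t0 tk]; exists (g, t); split=> //=.
  by rewrite mem_enum finset.inE generatorE// gn.
by rewrite mem_partitions_upto st t0.
Qed.

Lemma padded_multiples_bounds i : i \in generator_partition_pairs ->
  [/\ (size i.2 <= k)%N, size (i.2 ++ nseq (l - size i.2) 0%N) = l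
    & (sumn (i.2 ++ nseq (l - size i.2) 0%N) <= k)%N].
Proof.
case/generator_partition_pairsP => _ _ t0 tk.
have sk : (size i.2 <= k)%N := leq_trans (size_leq_sumn_pos t0) tk.
split=> //; first by rewrite size_cat size_nseq subnKC//; lia.
by rewrite sumn_cat sumn_nseq mul0n addn0.
Qed.

(** The extra term is the generator, coming from the padding. Coefficients are at most [k + 1 < n],
    so distinct ones give distinct terms. *)
Lemma card_padded_multiples i : i \in generator_partition_pairs ->
  #|[set x in padded_multiples i]%SET| = (size (undup i.2)).+1.
Proof.
move=> iL; have [sk zE uE] := padded_multiples_bounds iL.
case/generator_partition_pairsP: iL => gn _ t0 tk.
have us : uniq [seq i.1 *+ y.+1 | y <- 0%N :: undup i.2].
  rewrite map_inj_in_uniq; first by rewrite /= mem_undup t0 undup_uniq.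
  have le x : x \in 0%N :: undup i.2 -> (x <= k)%N.
    by rewrite inE mem_undup => /orP[/eqP->//|/leq_mem_sumn/leq_trans->].
  move=> x y /le xk /le yk /mulrn_inj_lt H.
  have nk : (k.+1 < n)%N by move: kl; rewrite /l; lia.
  by apply: succn_inj; apply: H; rewrite gn; lia.
have -> : (size (undup i.2)).+1 = size [seq i.1 *+ y.+1 | y <- 0%N :: undup i.2].
  by rewrite size_map.
rewrite -(card_uniqP us); apply: eq_card => x; rewrite finset.inE.
apply: eq_mem_map => y; rewrite mem_cat mem_nseq inE mem_undup orbC.
by have -> : (0 < l - size i.2)%N by lia.
Qed.

(** Forming [seq_mset (padded_multiples i)] is a bijection: injective by [generator_unique] and
    [perm_multiples], onto by [zsum_free_structure], with zero-sum free values by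
    [zsum_free_multiples]. *)
Lemma num_zero_sum_freeE (A : {set 'Z_n}) : num_zero_sum_free l A =
  count (fun i => [set x in padded_multiples i]%SET \subset A)
        generator_partition_pairs.
Proof.
rewrite /num_zero_sum_free -size_filter.
rewrite -(size_map (fun i => seq_mset (padded_multiples i))).
apply/perm_size/uniq_perm; first exact: fset_uniq.
  rewrite map_inj_in_uniq.
    apply/filter_uniq/allpairs_uniq; [exact: enum_uniq|exact: bounded_seqs_uniq|].
    by move=> [? ?] [? ?].
  move=> [g t] [g' t']; rewrite !mem_filter => /andP[_ iL] /andP[_ jL].
  have [_ zi ui] := padded_multiples_bounds iL.
  have [_ zj uj] := padded_multiples_bounds jL.
  case/generator_partition_pairsP: iL => /= gn st t0 _.
  case/generator_partition_pairsP: jL => /= g'n st' t'0 _.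
  move=> /eq_seq_msetP ij.
  have gg' := generator_unique hn hk h31 h62 gn g'n zi ui zj uj ij.
  rewrite -gg' in ij *; congr (_, _).
  have := perm_multiples _ _ ij; rewrite /= zi zj gn => H.
  have {}H := H (leq_ltn_trans (leq_add ui (leqnn l)) kln)
    (leq_ltn_trans (leq_add uj (leqnn l)) kln).
  (* Deleting the zeros undoes the padding; two sorted lists that are permutations of each other are
     then equal. *)
  have F (u : seq nat) m : 0%N \notin u ->
      [seq y <- u ++ nseq m 0%N | y != 0%N] = u.
    move=> u0; rewrite filter_cat.
    have -> : [seq y <- nseq m 0%N | y != 0%N] = [::] by elim: m.
    rewrite cats0; apply/all_filterP/allP => y yu.
    by apply: contraNneq u0 => <-.
  have := perm_filter (fun y => y != 0%N) H; rewrite !F//.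
  exact: (sorted_eq leq_trans anti_leq).
move=> S; rewrite inE/=.
apply/andP/mapP => [[/imfsetP[t _ ->] /asboolP[]]|].
  move=> /zero_sum_free_seq_mset z /contained_seq_mset c.
  have [|g [ys [gn tE yk]]] := zsum_free_structure hn hk h31 h62 _ z.
    by rewrite size_tuple.
  have sy : size ys = l by rewrite -(size_tuple t) (perm_size tE) size_map.
  (* The partition is read off from the structure theorem by dropping the zeros and sorting. *)
  pose u := sort leq [seq y <- ys | y != 0%N].
  have uE : perm_eq u [seq y <- ys | y != 0%N] by rewrite perm_sort.
  have yE : perm_eq ys (u ++ nseq (l - size u) 0%N).
    rewrite (permPl (perm_filter_neq0 ys)).
    have -> : (l - size u = count_mem 0 ys)%N.
      rewrite (perm_size uE) -sy {1}(perm_size (perm_filter_neq0 ys)).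
      by rewrite size_cat size_nseq addKn.
    by rewrite perm_cat2r perm_sym.
  have tE' : perm_eq t (padded_multiples (g, u)).
    by apply: (perm_trans tE); apply: perm_map.
  exists (g, u); last exact/eq_seq_msetP.
  rewrite mem_filter; apply/andP; split.
    have -> // : [set x in padded_multiples (g, u)]%SET = [set x in tval t]%SET.
    by apply/finset.setP => x; rewrite !finset.inE (perm_mem tE').
  apply/generator_partition_pairsP; split=> //=.
  - exact: (sort_sorted leq_total).
  - by rewrite (perm_mem uE) mem_filter.
  - apply: leq_trans yk; rewrite !sumnE (perm_big _ yE) big_cat/=; exact: leq_addr.
move=> [i]; rewrite mem_filter => /andP[c iL] ->.
have [_ zi ui] := padded_multiples_bounds iL.
case/generator_partition_pairsP: iL => gn st t0 _.
have sz : size (padded_multiples i) == l by rewrite size_map zi.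
split; first by apply/imfsetP; exists (Tuple sz).
apply/asboolP; split; last exact/contained_seq_mset.
apply/zero_sum_free_seq_mset/zsum_free_multiples; rewrite zi [X in (_ < X)%N]gn.
exact: leq_ltn_trans (leq_add ui (leqnn l)) kln.
Qed.

End Counting.

Unset Implicit Arguments.

(* The pairs (n, k) = (3, 1) and (6, 2) are excluded: they satisfy
   0 <= k <= n/3, but there the identity fails for every p > 0. *)
Theorem theorem2 (n k : nat) (hn : (2 <= n)%N) (hk : (k <= n %/ 3)%N)
    (h31 : (n, k) <> (3%N, 1%N)) (h62 : (n, k) <> (6%N, 2%N))
    (d0 : measure_display) (W : measurableType d0) (R : realType)
    (P : probability W R) (p : R) (X : W -> {set 'Z_n})
    (hX : random_subset P p X) :
  let D : nat := Num.truncn ((1 + Num.sqrt (1 + 8 * k%:R)) / 2 : R) in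
  ('E_P[fun w : W => (num_zero_sum_free (n - 1 - k) (X w))%:R : R] =
    ((num_generators n)%:R *
      (p + \sum_(2 <= d < D.+1) p ^+ d *
             (\sum_(((d - 1) * d) %/ 2 <= j < k.+1)
                num_partitions j (d - 1))%N%:R))%:E)%E.
Proof.
move=> D; rewrite partition_weight_sum.
have -> : (fun w : W => (num_zero_sum_free (n - 1 - k) (X w))%:R : R) =
    (fun w => (count (fun i => [set x in padded_multiples k i]%SET \subset X w)
        (generator_partition_pairs n k))%:R).
  by apply/funext => w; rewrite num_zero_sum_freeE.
rewrite (expectation_count_subset _ _ hX); congr EFin.
(* The weight of a pair depends only on its partition, so the sum over generators contributes the
   factor [num_generators n]. *)
rewrite big_seq; under eq_bigr => i iL do rewrite card_padded_multiples//.
rewrite -big_seq big_allpairs_dep/=.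
rewrite big_const_seq count_predT -cardE iter_addr_0 mulr_natl.
by [].
Qed.
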